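(* Let $G$ be a simple connected graph with at least one edge, let $k\ge2$ and $n\ge1$ be integers. Let $\mathcal{L}^k_m$ denote the normalized Laplacian matrix of the $m$-th $k$-hexagonal graph $H^k_m(G)$, and let $N^k_m$ and $E^k_m$ denote the order and size of $H^k_m(G)$. The normalized Laplacian spectrum of $H^k_n(G)$ is given by the following. (i) If $\sigma$ is an eigenvalue of $\mathcal{L}^k_{n-1}$ with $\sigma\ne0,2$, then $\lambda_1,\dots,\lambda_5$ are eigenvalues of $\mathcal{L}^k_n$ with $m_{\mathcal{L}^k_n}(\lambda_i)=m_{\mathcal{L}^k_{n-1}}(\sigma)$ for $i=1,\dots,5$, where $\lambda_1,\dots,\lambda_5$ are the roots (in $\lambda$) of $$(16k+16)\lambda^5-(80k+64+16\sigma)\lambda^4+(140k+84+64\sigma)\lambda^3-(100k+40+84\sigma)\lambda^2+(25k+5+40\sigma)\lambda-\sigma(k+5)=0.$$ (ii) $0$, $\frac{5k+3-\sqrt{5k^2+6k+5}}{4(k+1)}$ and $\frac{5k+3+\sqrt{5k^2+6k+5}}{4(k+1)}$ are eigenvalues of $\mathcal{L}^k_n$, each with multiplicity $1$. (iii) If $G$ is bipartite, $2$, $\frac{3k+5-\sqrt{5k^2+6k+5}}{4(k+1)}$ and $\frac{3k+5+\sqrt{5k^2+6k+5}}{4(k+1)}$ are eigenvalues of $\mathcal{L}^k_n$, each with multiplicity $1$. (iv) $\frac{5-\sqrt5}{4}$ and $\frac{5+\sqrt5}{4}$ are eigenvalues of $\mathcal{L}^k_n$, each with multiplicity $kE^k_{n-1}-N^k_{n-1}+1$.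 (v) If $G$ is bipartite, $\frac{3-\sqrt5}{4}$ and $\frac{3+\sqrt5}{4}$ are eigenvalues of $\mathcal{L}^k_n$, each with multiplicity $kE^k_{n-1}-N^k_{n-1}+1$. (vi) If $G$ is non-bipartite, $\frac{3-\sqrt5}{4}$ and $\frac{3+\sqrt5}{4}$ are eigenvalues of $\mathcal{L}^k_n$, each with multiplicity $kE^k_{n-1}-N^k_{n-1}$. (These items together describe the whole spectrum of $\mathcal{L}^k_n$.)
   Context: Graphs are finite, simple and connected. The $k$-hexagonal graph $H^k(G)$ of $G$ is obtained by replacing each edge $uv$ of $G$ by $k+1$ internally disjoint $u$–$v$ paths, one of length $1$ (the edge $uv$ itself) and $k$ of length $5$ (each with 4 new internal vertices). Set $H^k_0(G)=G$ and $H^k_n(G)=H^k(H^k_{n-1}(G))$ for $n\ge1$. With $N^k_n,E^k_n$ the numbers of vertices and edges of $H^k_n(G)$, $N^k_n=N^k_0+\frac45((5k+1)^n-1)E^k_0$ and $E^k_n=(5k+1)^nE^k_0$. The normalized Laplacian of a graph with adjacency matrix $A$ and diagonal degree matrix $D$ is $\mathcal{L}=D^{-1/2}(D-A)D^{-1/2}=I-D^{-1/2}AD^{-1/2}$; the normalized Laplacian spectrum is the multiset of its eigenvalues. $m_{M}(\sigma)$ denotes the multiplicity of $\sigma$ as an eigenvalue of the matrix $M$; ''eigenvalue of multiplicity $0$'' means that the number is not an eigenvalue. *)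

(* Defs.v *)
From HB Require Import structures.
From mathcomp Require Import all_boot all_order all_algebra.

Set Implicit Arguments.
Unset Strict Implicit.
Unset Printing Implicit Defensive.

Import Order.TTheory GRing.Theory Num.Theory.

Local Open Scope ring_scope.

Record sgraph := SGraph {
  vertex :> finType;
  adj : rel vertex;
  adj_sym : symmetric adj;
  adj_irr : irreflexive adj
}.

Definition connected (G : sgraph) : Prop :=
  forall x y : G, connect (@adj G) x y.

Definition bipartite (G : sgraph) : Prop :=
  exists c : G -> bool, forall x y : G, adj x y -> c x != c y.

Definition edges (G : sgraph) : {set {set G}} :=
  [set [set p.1; p.2] | p : G * G & adj p.1 p.2].

Definition graph_order (G : sgraph) : nat := #|G|.
Definition graph_size (G : sgraph) : nat := #|edges G|.

Definition degree (G : sgraph) (x : G) : nat := #|[set y : G | adj x y]|.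

Section KHexagonal.
Variables (k : nat) (G : sgraph).

Definition dart := {p : G * G | adj p.1 p.2}.

(* The new vertices are named by the half-paths they lie on, which avoids     *)
(* choosing an orientation of the edges. For each edge uv and i < k, the i-th *)
(* added path of length 5 is                                                  *)
(*   u - (uv, i, false) - (uv, i, true) - (vu, i, true) - (vu, i, false) - v, *)
(* where uv and vu are the two darts of the edge, so that the boolean says    *)
(* whether the distance along the path to the source of the dart is 1 or 2.   *)
Definition khex_vertex : finType := (G + dart * 'I_k * bool)%type.

Definition khex_arc (x y : khex_vertex) : bool :=
  match x, y with
  | inl u, inl v => adj u v
  | inl u, inr (d, _, false) => u == (val d).1
  | inr (d, i, false), inr (d', i', true) => (d == d') && (i == i')
  | inr (d, i, true), inr (d', i', true) =>
      (val d' == ((val d).2, (val d).1)) && (i == i')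
  | _, _ => false
  end.

Definition khex_adj : rel khex_vertex :=
  [rel x y | khex_arc x y || khex_arc y x].

Lemma khex_adj_sym : symmetric khex_adj.
Proof. by move=> x y; apply: orbC. Qed.

Lemma khex_adj_irr : irreflexive khex_adj.
Proof.
case=> [u | [[[[u v] /= uv] i] [|]]]; rewrite /khex_adj /= ?adj_irr ?orbb //.
apply/negbTE/negP => /andP[/eqP[_ e] _].
by move: uv; rewrite e adj_irr.
Qed.

Definition khex : sgraph := SGraph khex_adj_sym khex_adj_irr.

End KHexagonal.

Definition khex_iter (k n : nat) (G : sgraph) : sgraph := iter n (khex k) G.

Section NormalizedLaplacian.
Variables (R : rcfType) (G : sgraph).

Definition adjacency_mx : 'M[R]_#|G| :=
  \matrix_(i, j) (adj (enum_val i) (enum_val j))%:R.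

Definition degree_mx : 'M[R]_#|G| :=
  diag_mx (\row_i (degree (enum_val i))%:R).

Definition degree_invsqrt_mx : 'M[R]_#|G| :=
  diag_mx (\row_i (Num.sqrt (degree (enum_val i))%:R)^-1).

Definition normalized_laplacian : 'M[R]_#|G| :=
  degree_invsqrt_mx *m (degree_mx - adjacency_mx) *m degree_invsqrt_mx.

End NormalizedLaplacian.

Definition mult (R : rcfType) (m : nat) (M : 'M[R]_m) (a : R) : nat :=
  mup a (char_poly M).

Definition khex_quintic (R : rcfType) (k : nat) (s : R) : {poly R} :=
  let K : R := k%:R in
  (16 * K + 16) *: 'X^5
  - (80 * K + 64 + 16 * s) *: 'X^4
  + (140 * K + 84 + 64 * s) *: 'X^3
  - (100 * K + 40 + 84 * s) *: 'X^2
  + (25 * K + 5 + 40 * s) *: 'X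
  - (s * (K + 5))%:P.

(* Main.v *)
Require Import Defs.
From HB Require Import structures.
From mathcomp Require Import all_boot all_order all_algebra complex zify ring lra.

Set Implicit Arguments.
Unset Strict Implicit.
Unset Printing Implicit Defensive.

Import Order.TTheory GRing.Theory Num.Theory.

Local Open Scope ring_scope.

(** Write a candidate eigenvalue of the normalized Laplacian as [1 - mu].
Conjugating by the square root of the degree matrix turns the eigenvectors
into functions [f] with
  [\sum_(v ~ u) f v = mu * deg u * f u] at every vertex [u],
the eigenfunctions of the simple random walk; since the Laplacian is
symmetric, the multiplicity of [1 - mu] as a root of the characteristic
polynomial is the dimension of this space ([mult_symmetric], [mult_walk]).

Let [H] be the hexagonal graph of [G].  At the four inner vertices of an added
path the equation is the Chebyshev recurrence, so the first inner value [a]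
and the values [x], [y] at the two ends of the path satisfy
[U_4 mu * a = U_3 mu * x + y] ([near_of_ends]), where [U_4] and [U_3] are
[cheb4] and [cheb3].

Away from the zeros of [U_4] the end values determine [f], and eliminating the
inner vertices from the equation at an old vertex leaves
  [((k + 1) * mu * U_4 - k * U_3) f = (U_4 + k) * (walk operator of G) f].
Restriction to the old vertices is therefore an isomorphism from the
[mu]-eigenspace of [H] to the [theta]-eigenspace of [G]
([dim_khex_generic]), where [theta] is given by the quintic relation; the
denominator [U_4 + k] is positive because [U_4 >= - 5 / 4] and [2 <= k].
The quintic changes sign between consecutive points of
  [0, (3 - sqrt 5)/4, (5 - sqrt 5)/4, (3 + sqrt 5)/4, (5 + sqrt 5)/4, 2],
so that it has five real roots whenever [0 < sigma < 2]
([khex_quintic_split]).  For [sigma = 0] and [sigma = 2] it factors: two of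
the five roots become zeros of [U_4], and the others, namely [sigma] itself and
the two roots of a quadratic ([sigma0_quadratic]), inherit the multiplicity of
[sigma] in [G], which connectedness and bipartiteness determine.

At the four zeros of [U_4] one has [U_3 mu = e] with [e = 1] or [e = -1].
There an eigenfunction vanishes on the old vertices, and what remains is a
function on the oriented added paths, multiplied by [e] under reversal, whose
values sum to zero around every old vertex ([dim_khex_exceptional]).  For
[e = -1] these are the flows of the multigraph carrying [k] parallel copies of
each edge of [G]; for either sign their dimension is [k * E - N] plus the
dimension of the [- e]-eigenspace of [G], since the cokernel of the boundary
map is that eigenspace ([dim_circulations]).  The latter has dimension 1 for
[e = -1], and for [e = 1] dimension 1 or 0 according as [G] is bipartite or
not. *)

(** * Multiplicities of eigenvalues of symmetric matrices *)

Lemma mup_map (F K : fieldType) (f : {rmorphism F -> K}) (p : {poly F}) a :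
  p != 0 -> mup (f a) (map_poly f p) = mup a p.
Proof.
move=> p0; have fp0 : map_poly f p != 0 by rewrite map_poly_eq0.
have H m : (m <= mup (f a) (map_poly f p))%N = (m <= mup a p)%N.
  by rewrite !mup_geq // -map_polyXsubC -rmorphXn /= dvdp_map.
by apply/eqP; rewrite eqn_leq -H leqnn H leqnn.
Qed.

Lemma mup_prod_XsubC (F : fieldType) (I : finType) (d : I -> F) a :
  mup a (\prod_i ('X - (d i)%:P)) = #|[set i | d i == a]|.
Proof.
rewrite -sum1_card.
have H (r : seq I) : mup a (\prod_(i <- r) ('X - (d i)%:P)) =
   (\sum_(i <- r | d i == a) 1)%N /\ \prod_(i <- r) ('X - (d i)%:P) != 0.
  elim: r => [|i r [IH n0]].
    by rewrite !big_nil oner_neq0; split=> //; apply: mupNroot; rewrite root1.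
  rewrite !big_cons mulf_neq0 ?polyXsubC_eq0 //; split=> //.
  rewrite mupM ?polyXsubC_eq0 // IH -['X - _]expr1 mup_XsubCX.
  by case: ifP.
rewrite (H _).1; apply: eq_bigl => i; by rewrite inE.
Qed.

Lemma rank_diag_mx (F : fieldType) n (d : 'rV[F]_n) :
  \rank (diag_mx d) = #|[set i | d 0 i != 0]|.
Proof.
have -> : \rank (diag_mx d) =
    \rank (\sum_(i | d 0 i != 0) <<delta_mx 0 i : 'rV[F]_n>>)%MS.
  apply: eqmx_rank; apply/andP; split.
    apply/row_subP=> i; rewrite row_diag_mx.
    have [->|di] := eqVneq (d 0 i) 0; first by rewrite scale0r sub0mx.
    by apply/scalemx_sub/(sumsmx_sup i); rewrite ?genmxE.
  apply/sumsmx_subP=> i di; rewrite genmxE.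
  apply: (submx_trans _ (row_sub i _)).
  by rewrite row_diag_mx eqmx_scale.
have /mxdirectP -> /= : mxdirect (\sum_(i | d 0 i != 0) <<delta_mx 0 i : 'rV[F]_n>>).
  by apply: mxdirect_delta => i j _ _.
rewrite -sum1_card; apply: eq_big => [i|i _]; first by rewrite inE.
by rewrite mxrank_gen mxrank_delta.
Qed.

Lemma char_poly_conj (F : fieldType) n (P A : 'M[F]_n) :
  P \in unitmx -> char_poly (invmx P *m A *m P) = char_poly A.
Proof.
move=> uP; rewrite /char_poly.
have -> : char_poly_mx (invmx P *m A *m P) =
    map_mx polyC (invmx P) *m char_poly_mx A *m map_mx polyC P.
  rewrite /char_poly_mx !map_mxM mulmxBr mulmxBl scalar_mxC -[_%:M *m _ *m _]mulmxA.
  have -> : map_mx polyC (invmx P) *m map_mx polyC P = 1%:M :> 'M[{poly F}]_n.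
    by rewrite -map_mxM mulVmx // map_mx1.
  by rewrite mulmx1.
rewrite !det_mulmx mulrC mulrA -det_mulmx -map_mxM mulmxV // map_mx1 det1.
by rewrite mul1r.
Qed.

(** Over the complex extension a real symmetric matrix is normal, hence unitarily
diagonalizable; for a diagonal matrix both sides count the diagonal entries
equal to [a], and both are unchanged by scalar extension and conjugation. *)
Lemma mult_symmetric (R : rcfType) n (A : 'M[R]_n) a :
  A^T = A -> mult A a = \rank (eigenspace A a).
Proof.
move=> symA; pose f : {rmorphism R -> complex R} := real_complex R.
pose B := map_mx f A.
have /orthomx_spectralP eB : B \is normalmx.
  apply: symmetric_normalmx.
    by apply/is_hermitianmxP; rewrite expr0 scale1r map_mx_id // /B map_trmx symA.
  by apply/mxOverP=> i j; rewrite mxE; apply/complex_realP; exists (A i j).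
have uP := spectral_unit B.
move: eB uP; set P := spectralmx B; set d := spectral_diag B => eB uP.
have p0 : char_poly A != 0 by rewrite monic_neq0 // char_poly_monic.
rewrite /mult -(mup_map f) // map_char_poly -/B eB char_poly_conj //.
rewrite char_poly_trig ?diag_mx_is_trig // mup_prod_XsubC.
rewrite mxrank_ker -(mxrank_map f) map_mxB -/B map_scalar_mx eB.
have -> : invmx P *m diag_mx d *m P - (f a)%:M =
    invmx P *m diag_mx (d - const_mx (f a)) *m P.
  rewrite linearB /= mulmxBr mulmxBl diag_const_mx; congr (_ - _).
  by rewrite -mulmxA mul_scalar_mx -scalemxAr mulVmx // scalemx1.
rewrite mxrankMfree ?row_free_unit // eqmxMfull; last first.
  by rewrite row_full_unit unitmx_inv.
rewrite rank_diag_mx.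
set S := [set i | _ == _].
have -> : [set i | (d - const_mx (f a)) 0 i != 0] = ~: S.
  by apply/setP=> i; rewrite !inE !mxE eqxx mulr1n subr_eq0.
by have := cardsC S; rewrite card_ord; lia.
Qed.

(** * From the normalized Laplacian to the random walk *)

(** Stated on elements, so that each later computation of a dimension reduces to
exhibiting an explicit correspondence between eigenfunctions. *)
Lemma dim_linear_bij (F : fieldType) (aT rT : vectType F)
    (g : {linear aT -> rT}) (U : {vspace aT}) (V : {vspace rT}) :
  {in U, forall x, g x = 0 -> x = 0} ->
  (forall x, x \in U -> g x \in V) ->
  (forall y, y \in V -> exists2 x, x \in U & y = g x) ->
  \dim V = \dim U.
Proof.
move=> gI gV Vg; have -> : V = (linfun g @: U)%VS.
  apply/vspaceP=> y; apply/idP/memv_imgP => [/Vg[x xU ->]|[x xU ->]].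
    by exists x; rewrite // lfunE.
  by rewrite lfunE; apply: gV.
apply: limg_dim_eq; apply/eqP; rewrite -subv0; apply/subvP=> x.
by rewrite memv_cap memv_ker lfunE memv0 => /andP[xU /eqP/(gI _ xU)->].
Qed.

Section WalkEigenspace.
Variables (R : rcfType) (G : sgraph).
Implicit Types (mu : R) (f : {ffun G -> R^o}).

(** The operator [A - mu D]; clearing the degrees avoids divisions. *)
Definition walk_op mu f : {ffun G -> R^o} :=
  [ffun u => \sum_(v | adj u v) f v - mu * (degree u)%:R * f u].

Fact walk_op_linear mu : linear (walk_op mu).
Proof.
move=> c f g; apply/ffunP=> u; rewrite !ffunE.
under eq_bigr do rewrite !ffunE.
rewrite big_split -scaler_sumr /=.
by rewrite /GRing.scale /=; ring.
Qed.

HB.instance Definition _ mu :=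
  GRing.isLinear.Build R _ _ _ (walk_op mu) (walk_op_linear mu).

Definition walk_eigenspace mu : {vspace {ffun G -> R^o}} :=
  lker (linfun (walk_op mu)).

Lemma walk_eigenspaceP mu f :
  reflect (forall u, \sum_(v | adj u v) f v = mu * (degree u)%:R * f u)
    (f \in walk_eigenspace mu).
Proof.
rewrite memv_ker lfunE; apply: (iffP eqP) => [/ffunP e u | e].
  by have := e u; rewrite !ffunE => /eqP; rewrite subr_eq0 => /eqP.
by apply/ffunP=> u; rewrite !ffunE e subrr.
Qed.

Local Notation invsqrt u := (Num.sqrt (degree u)%:R : R)^-1.

Definition rescale (v : 'rV[R]_#|G|) : {ffun G -> R^o} :=
  [ffun u => v 0 (enum_rank u) * invsqrt u].

Lemma normalized_laplacianE i j :
  normalized_laplacian R G i j =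
  invsqrt (enum_val i) * ((i == j)%:R * (degree (enum_val i))%:R
     - (adj (enum_val i) (enum_val j))%:R) * invsqrt (enum_val j).
Proof.
rewrite /normalized_laplacian /degree_invsqrt_mx mul_mx_diag mxE.
rewrite mul_diag_mx !mxE -mulr_natr; congr (_ * _ * _); congr (_ - _).
by case: eqP => [->|]; rewrite ?mulr1 ?mul1r ?mulr0 ?mul0r.
Qed.

Lemma normalized_laplacian_sym :
  (normalized_laplacian R G)^T = normalized_laplacian R G.
Proof.
apply/matrixP=> i j; rewrite mxE !normalized_laplacianE eq_sym adj_sym.
by case: eqP => [->|_]; rewrite ?mul0r; ring.
Qed.

Lemma eigenvalue_mult a :
  eigenvalue (normalized_laplacian R G) a =
  (mult (normalized_laplacian R G) a != 0%N).
Proof.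
by rewrite mult_symmetric ?normalized_laplacian_sym // mxrank_eq0.
Qed.

Hypothesis deg_gt0 : forall u : G, (0 < degree u)%N.

Lemma sqrt_degree_sqr (u : G) : invsqrt u ^+ 2 * (degree u)%:R = 1.
Proof.
rewrite exprVn sqr_sqrtr ?ler0n // mulVf // pnatr_eq0 -lt0n; exact: deg_gt0.
Qed.

(** With [f = v D^(-1/2)], the equation [v L = a v] reads [f (D - A) = a f D]. *)
Lemma eigenspace_walk v a :
  (v <= eigenspace (normalized_laplacian R G) a)%MS =
  (rescale v \in walk_eigenspace (1 - a)).
Proof.
have H u : (v *m normalized_laplacian R G) 0 (enum_rank u) =
    (rescale v u * (degree u)%:R - \sum_(w | adj u w) rescale v w) * invsqrt u.
  rewrite mxE (reindex (@enum_rank G)) /=; last first.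
    by exists enum_val => x _; rewrite ?enum_rankK ?enum_valK.
  rewrite (eq_bigr (fun w => ((w == u)%:R * (rescale v w * (degree w)%:R)
     - (adj u w)%:R * rescale v w) * invsqrt u)); last first.
    move=> w _; rewrite normalized_laplacianE !enum_rankK ffunE.
    by rewrite (inj_eq enum_rank_inj) adj_sym; ring.
  rewrite -mulr_suml sumrB (bigD1 u) //= eqxx big1 ?addr0 ?mul1r; last first.
    by move=> w /negPf->; rewrite mul0r.
  rewrite [in RHS]big_mkcond /=; congr ((_ - _) * _); apply: eq_bigr => w _.
  by case: ifP; rewrite ?mul1r ?mul0r.
have s0 (u : G) : invsqrt u != 0 :> R.
  by rewrite invr_eq0 sqrtr_eq0 -ltNge ltr0n; apply: deg_gt0.
have ve u : v 0 (enum_rank u) = rescale v u * (degree u)%:R * invsqrt u.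
  rewrite ffunE; transitivity (v 0 (enum_rank u) * (invsqrt u ^+ 2 * (degree u)%:R)).
    by rewrite sqrt_degree_sqr mulr1.
  by ring.
apply/eigenspaceP/walk_eigenspaceP => [/rowP e u | e].
  have := e (enum_rank u); rewrite H mxE ve mulrA => /(mulIf (s0 u)) {}e.
  by apply/eqP; rewrite -subr_eq0 -oppr_eq0; apply/eqP; lra.
apply/rowP=> i; rewrite -(enum_valK i) H mxE ve e; ring.
Qed.

Lemma mult_walk a :
  mult (normalized_laplacian R G) a = \dim (walk_eigenspace (1 - a)).
Proof.
rewrite mult_symmetric ?normalized_laplacian_sym //.
set E := eigenspace _ a; pose B := row_base E.
pose g (u : 'rV[R]_(\rank E)) := rescale (u *m B).
have g_lin : linear g.
  move=> c u w; apply/ffunP=> x; rewrite !ffunE mulmxDl -scalemxAl !mxE.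
  by rewrite /GRing.scale /=; ring.
pose gM := GRing.isLinear.Build R _ _ _ g g_lin.
pose gL : {linear 'rV[R]_(\rank E) -> {ffun G -> R^o}} := HB.pack g gM.
have s0 (u : G) : invsqrt u != 0 :> R.
  by rewrite invr_eq0 sqrtr_eq0 -ltNge ltr0n; apply: deg_gt0.
rewrite (@dim_linear_bij _ _ _ gL fullv).
- by rewrite dimvf /dim /= mul1n.
- move=> u _ /ffunP gu0; have : u *m B = 0.
    apply/rowP=> i; have := gu0 (enum_val i); rewrite !ffunE enum_valK => /eqP.
    by rewrite mulf_eq0 (negPf (s0 _)) orbF => /eqP->; rewrite mxE.
  by move/eqP; rewrite mulmx_free_eq0 ?row_base_free // => /eqP.
- move=> u _; rewrite /= /g -eigenspace_walk -/E -(eq_row_base E).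
  exact: submxMl.
- move=> y yW.
  pose v : 'rV[R]_#|G| := \row_i (y (enum_val i) / invsqrt (enum_val i)).
  have ev : rescale v = y.
    by apply/ffunP=> u; rewrite !ffunE mxE enum_rankK divfK.
  have : (v <= B)%MS by rewrite eq_row_base eigenspace_walk ev.
  by case/submxP=> u eu; exists u; rewrite ?memvf //= /g -eu ev.
Qed.

Lemma eigenvalue_walk a :
  eigenvalue (normalized_laplacian R G) a = (walk_eigenspace (1 - a) != 0%VS).
Proof.
by rewrite eigenvalue_mult mult_walk dimv_eq0.
Qed.

End WalkEigenspace.

(** * Darts and the energy identity *)

Section Darts.
Variable G : sgraph.

Definition dsrc (d : dart G) : G := (val d).1.
Definition dtgt (d : dart G) : G := (val d).2.

Fact drev_subproof (d : dart G) : adj (dtgt d, dsrc d).1 (dtgt d, dsrc d).2.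
Proof. by rewrite adj_sym; apply: (valP d). Qed.

Definition drev (d : dart G) : dart G := Sub (dtgt d, dsrc d) (drev_subproof d).

Lemma drevK : involutive drev.
Proof. by move=> d; apply: val_inj; case: d => [[]]. Qed.

Lemma adj_dart (d : dart G) : adj (dsrc d) (dtgt d).
Proof. exact: (valP d). Qed.

Lemma dart_of_adj (u v : G) :
  adj u v -> {d : dart G | dsrc d = u & dtgt d = v}.
Proof. by move=> uv; exists (Sub (u, v) (uv : adj (u, v).1 (u, v).2)). Qed.

Lemma dart_eq (d e : dart G) : dsrc d = dsrc e -> dtgt d = dtgt e -> d = e.
Proof.
case: d e => [[a b] ab] [[a' b'] ab'] /= e1 e2; apply: val_inj => /=.
by congr (_, _).
Qed.

Lemma sum_dart_rev (V : zmodType) (F : dart G -> V) :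
  \sum_d F (drev d) = \sum_d F d.
Proof. by rewrite [RHS](reindex_inj (inv_inj drevK)). Qed.

Lemma sum_dart_src (V : zmodType) (F : G -> V) u :
  \sum_(d : dart G | dsrc d == u) F (dtgt d) = \sum_(v | adj u v) F v.
Proof.
rewrite (reindex_omap dtgt (fun v => insub (u, v) : option (dart G))) /=; last first.
  by move=> v uv; rewrite insubT.
apply: eq_bigl => d; rewrite /dsrc /dtgt.
case: d => [[a b] /= ab].
apply/eqP/andP => [<-|[ub]].
  by rewrite ab insubT.
by rewrite insubT => /eqP[].
Qed.

Lemma sum_dart (V : zmodType) (F : dart G -> V) :
  \sum_d F d = \sum_u \sum_(d | dsrc d == u) F d.
Proof. exact: (partition_big dsrc predT). Qed.

Lemma degree_sum (R : nzRingType) (u : G) :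
  (degree u)%:R = \sum_(v | adj u v) 1 :> R.
Proof. by rewrite sumr_const /degree cardsE. Qed.

Lemma degree_sum_dart (R : nzRingType) (u : G) :
  (degree u)%:R = \sum_(d : dart G | dsrc d == u) 1 :> R.
Proof. by rewrite degree_sum -(sum_dart_src (fun=> 1)). Qed.

End Darts.

Section Energy.
Variables (R : rcfType) (G : sgraph).
Implicit Types (mu e : R) (f : {ffun G -> R^o}).

(** Expanding the square, the two square terms agree by reversal of darts and the
cross terms are evaluated by the eigenvalue equation.  The sign [e] yields at
once the bound on the spectrum and the description of the extreme eigenspaces. *)
Lemma walk_energy mu e f : e ^+ 2 = 1 -> f \in walk_eigenspace G mu ->
  \sum_d (f (dsrc d) + e * f (dtgt d)) ^+ 2 =
  2 * (1 + e * mu) * \sum_u (degree u)%:R * f u ^+ 2 :> R.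
Proof.
move=> e2 /walk_eigenspaceP fW.
have sqsrc : \sum_d f (dsrc d) ^+ 2 = \sum_u (degree u)%:R * f u ^+ 2 :> R.
  rewrite sum_dart; apply: eq_bigr => u _.
  rewrite degree_sum_dart mulr_suml; apply: eq_bigr => d /eqP->.
  by rewrite mul1r.
have sqtgt : \sum_d f (dtgt d) ^+ 2 = \sum_u (degree u)%:R * f u ^+ 2 :> R.
  by rewrite -sqsrc -[RHS]sum_dart_rev.
have cross : \sum_d f (dsrc d) * f (dtgt d) =
    mu * \sum_u (degree u)%:R * f u ^+ 2 :> R.
  rewrite sum_dart mulr_sumr; apply: eq_bigr => u _.
  transitivity (f u * \sum_(v | adj u v) f v).
    rewrite -(sum_dart_src f) mulr_sumr.
    by apply: eq_bigr => d /eqP->.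
  by rewrite fW; ring.
transitivity (\sum_(d : dart G) (f (dsrc d) ^+ 2 +
    (f (dtgt d) ^+ 2 + 2 * e * (f (dsrc d) * f (dtgt d)))) : R).
  by apply: eq_bigr => d _; ring: e2.
by rewrite !big_split -mulr_sumr /= sqsrc sqtgt cross; ring.
Qed.

(** At [mu = - e] the energy vanishes, and a sum of squares is zero only when each
of them is. *)
Lemma walk_eigenspace_sign e f : e ^+ 2 = 1 ->
  reflect (forall u v, adj u v -> f u = - e * f v) (f \in walk_eigenspace G (- e)).
Proof.
move=> e2; apply: (iffP idP) => [fW u v uv | fE].
  have := walk_energy e2 fW.
  have -> : 2 * (1 + e * - e) = 0 by ring: e2.
  rewrite mul0r => /psumr_eq0P H; have [d <- <-] := dart_of_adj uv.
  have /eqP : (f (dsrc d) + e * f (dtgt d)) ^+ 2 = 0.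
    by apply: H => // ? _; apply: sqr_ge0.
  by rewrite sqrf_eq0 addr_eq0 => /eqP->; rewrite mulNr.
apply/walk_eigenspaceP=> u; rewrite degree_sum mulr_sumr mulr_suml.
apply: eq_bigr => v uv; rewrite (fE v u) ?mulr1 //.
by rewrite adj_sym.
Qed.

Lemma walk_eigenvalue_bound mu :
  (forall u : G, (0 < degree u)%N) ->
  walk_eigenspace G mu != 0%VS -> -1 <= mu <= 1.
Proof.
move=> deg_gt0; rewrite -vpick0; set f := vpick _ => f0.
have fW : f \in walk_eigenspace G mu by apply: memv_pick.
set S : R := \sum_u (degree u)%:R * f u ^+ 2.
have S0 : 0 < S.
  have Sge u : 0 <= (degree u)%:R * f u ^+ 2 :> R.
    by rewrite mulr_ge0 ?ler0n // sqr_ge0.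
  rewrite lt0r sumr_ge0 // andbT; apply: contraNneq f0.
  move=> /psumr_eq0P H; apply/eqP/ffunP=> u; rewrite ffunE.
  have /eqP := H (fun u _ => Sge u) u isT.
  by rewrite mulf_eq0 pnatr_eq0 -leqn0 leqNgt deg_gt0 sqrf_eq0 => /eqP.
have B e : e ^+ 2 = 1 -> 0 <= 1 + e * mu.
  move=> e2; have : 0 <= 2 * (1 + e * mu) * S.
    by rewrite -(walk_energy e2 fW) sumr_ge0 // => d _; apply: sqr_ge0.
  by rewrite pmulr_lge0 // pmulr_rge0.
by have := B 1 (expr1n _ _); have := B (-1) (etrans (sqrrN 1) (expr1n _ 2)); lra.
Qed.

Lemma connected_adj_const (T : Type) (F : G -> T) : connected G ->
  (forall u v, adj u v -> F u = F v) -> forall u v, F u = F v.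
Proof.
move=> conn FE u v; have /connectP[p pth ->] := conn u v.
elim: p u pth => //= w p IH u /andP[uw /IH <-]; exact: FE.
Qed.

(** Multiplying by the sign pattern [c] turns the functions of
[walk_eigenspace_sign] into locally constant ones.  Used with [c = 1] for
[e = -1], and with a proper 2-colouring for [e = 1]. *)
Lemma dim_walk_eigenspace_sgn e (c : G -> R) (u0 : G) :
  connected G -> e ^+ 2 = 1 ->
  (forall u, c u ^+ 2 = 1) -> (forall u v, adj u v -> c u = - e * c v) ->
  \dim (walk_eigenspace G (- e)) = 1%N.
Proof.
move=> conn e2 c2 cE.
pose h : {ffun G -> R^o} := [ffun u => c u].
suff -> : walk_eigenspace G (- e) = <[h]>%VS.
  rewrite dim_vline; suff -> : h != 0 by [].
  apply/eqP=> /ffunP/(_ u0); rewrite !ffunE => c0.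
  by have := c2 u0; rewrite c0 expr0n /= => /eqP; rewrite eq_sym oner_eq0.
apply/vspaceP=> f; apply/(walk_eigenspace_sign _ e2)/vlineP => [fE|[a ->] u v uv].
  exists (f u0 * c u0); apply/ffunP=> u; rewrite !ffunE /GRing.scale /=.
  (* [c] takes the values 1 and -1, so it is its own inverse *)
  have -> : f u0 * c u0 = f u * c u.
    apply: (@connected_adj_const _ (fun u => f u * c u)) => // w v wv.
    by rewrite (fE _ _ wv) (cE _ _ wv); ring: e2.
  by rewrite -mulrA -expr2 c2 mulr1.
by rewrite !ffunE /GRing.scale /= (cE _ _ uv); ring.
Qed.

(** A nonzero eigenfunction for [-1] changes sign along each edge and has constant
absolute value, so its sign is a proper 2-colouring. *)
Lemma bipartite_of_walk : connected G ->
  walk_eigenspace G (-1 : R) != 0%VS -> bipartite G.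
Proof.
move=> conn; rewrite -vpick0; set f := vpick _ => f0.
have /(walk_eigenspace_sign _ (expr1n _ 2)) fE : f \in walk_eigenspace G (-1 : R).
  exact: memv_pick.
exists (fun u => 0 < f u) => u v uv.
have fu0 : f u != 0.
  apply: contraNneq f0 => fu0; apply/eqP/ffunP=> w; rewrite ffunE.
  apply/eqP; rewrite -normr_eq0.
  rewrite (@connected_adj_const _ (fun u => `|f u|) conn _ w u) ?fu0 ?normr0 //.
  by move=> x y xy; rewrite (fE _ _ xy) mulN1r normrN.
have := fE _ _ uv; rewrite mulN1r => e; move: fu0; rewrite e oppr_gt0 oppr_eq0.
by case: ltgtP.
Qed.

End Energy.

(** * Signed circulations *)

Section Circulations.
Variables (R : rcfType) (G : sgraph) (k : nat).
Implicit Types (e : R) (g : {ffun dart G * 'I_k -> R^o}) (h : {ffun G -> R^o}).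

Definition twist_op e g : {ffun dart G * 'I_k -> R^o} :=
  [ffun p => g (drev p.1, p.2) - e * g p].

Fact twist_op_linear e : linear (twist_op e).
Proof.
move=> c f g; apply/ffunP=> u; rewrite !ffunE.
by rewrite /GRing.scale /=; ring.
Qed.

HB.instance Definition _ e :=
  GRing.isLinear.Build R _ _ _ (twist_op e) (twist_op_linear e).

(** Functions on the darts of the multigraph with [k] copies of every edge that are
multiplied by [e] under reversal: flows for [e = -1], edge weights for [e = 1].
Treating both signs together serves all four zeros of [U_4]. *)
Definition twisted e : {vspace {ffun dart G * 'I_k -> R^o}} :=
  lker (linfun (twist_op e)).

Lemma twistedP e g :
  reflect (forall d i, g (drev d, i) = e * g (d, i)) (g \in twisted e).
Proof.
rewrite memv_ker lfunE; apply: (iffP eqP) => [/ffunP ge d i | ge].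
  by have := ge (d, i); rewrite !ffunE => /eqP; rewrite subr_eq0 => /eqP.
by apply/ffunP=> -[d i]; rewrite !ffunE ge subrr.
Qed.

Definition boundary g : {ffun G -> R^o} :=
  [ffun u => \sum_(d | dsrc d == u) \sum_i g (d, i)].

Fact boundary_linear : linear boundary.
Proof.
move=> c f g; apply/ffunP=> u; rewrite !ffunE scaler_sumr -big_split.
apply: eq_bigr => d _; rewrite scaler_sumr -big_split.
by apply: eq_bigr => i _; rewrite !ffunE.
Qed.

HB.instance Definition _ :=
  GRing.isLinear.Build R _ _ _ boundary boundary_linear.

Definition coboundary e h : {ffun dart G * 'I_k -> R^o} :=
  [ffun p => h (dsrc p.1) + e * h (dtgt p.1)].

Fact coboundary_linear e : linear (coboundary e).
Proof.
move=> c f g; apply/ffunP=> u; rewrite !ffunE.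
by rewrite /GRing.scale /=; ring.
Qed.

HB.instance Definition _ e :=
  GRing.isLinear.Build R _ _ _ (coboundary e) (coboundary_linear e).

Definition circulations e : {vspace {ffun dart G * 'I_k -> R^o}} :=
  (twisted e :&: lker (linfun boundary))%VS.

Lemma circulationsP e g :
  reflect ((forall d i, g (drev d, i) = e * g (d, i)) /\
           (forall u, \sum_(d | dsrc d == u) \sum_i g (d, i) = 0))
    (g \in circulations e).
Proof.
rewrite memv_cap memv_ker lfunE.
apply: (iffP andP) => -[/twistedP ge bg]; split=> //.
  by move=> u; have /eqP/ffunP/(_ u) := bg; rewrite !ffunE.
by apply/eqP/ffunP=> u; rewrite !ffunE bg.
Qed.

(** The pairing is a sum over darts; reversing the darts multiplies [g] by [e] and
[h] by [- e], so the sum is its own opposite. *)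
Lemma boundary_orthogonal e g h : e ^+ 2 = 1 ->
  g \in twisted e -> h \in walk_eigenspace G (- e) ->
  \sum_u h u * boundary g u = 0.
Proof.
move=> e2 /twistedP ge /(walk_eigenspace_sign _ e2) hE.
pose s d := \sum_i g (d, i).
have srev d : s (drev d) = e * s d.
  by rewrite mulr_sumr; apply: eq_bigr => i _; rewrite ge.
have -> : \sum_u h u * boundary g u = \sum_d h (dsrc d) * s d.
  rewrite sum_dart; apply: eq_bigr => u _; rewrite ffunE mulr_sumr.
  by apply: eq_bigr => d /eqP->.
set S := \sum_d _; suff : S = - S by lra.
rewrite {1}/S -sum_dart_rev -sumrN; apply: eq_bigr => d _.
have -> : h (dsrc (drev d)) = - e * h (dsrc d).
  by apply: hE; rewrite adj_sym; apply: adj_dart.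
by rewrite srev; ring: e2.
Qed.

Lemma coboundary_twisted e h : e ^+ 2 = 1 -> coboundary e h \in twisted e.
Proof. by move=> e2; apply/twistedP=> d i; rewrite !ffunE /=; ring: e2. Qed.

Lemma dim_ffun (T : finType) : \dim {: {ffun T -> R^o}} = #|T|.
Proof. by rewrite dimvf /dim /= muln1. Qed.

(** The image of the boundary map is the orthogonal complement of the
[- e]-eigenspace: it meets that space only in [0] by orthogonality, and it
contains the image of boundary after coboundary, which is a multiple of
[D + e A] and so has that same eigenspace as kernel. *)
Lemma dim_boundary_twisted e : e ^+ 2 = 1 -> (0 < k)%N ->
  (\dim (linfun boundary @: twisted e) + \dim (walk_eigenspace G (- e)))%N = #|G|.
Proof.
move=> e2 k_gt0; apply/eqP; rewrite eqn_leq; apply/andP; split.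
  rewrite -dimv_disjoint_sum; first by rewrite -(dim_ffun G) dimvS ?subvf.
  apply/eqP; rewrite -subv0; apply/subvP=> h; rewrite memv_cap memv0.
  case/andP=> /memv_imgP[g ge]; rewrite lfunE /= => eh hW.
  have := boundary_orthogonal e2 ge hW; rewrite -eh => h0.
  apply/eqP/ffunP=> u; rewrite ffunE; apply/eqP.
  rewrite -[_ == _](sqrf_eq0 (h u)) expr2.
  have /psumr_eq0P H := h0; apply/eqP/H => // w _.
  by rewrite -expr2 sqr_ge0.
pose T := (linfun boundary \o linfun (coboundary e))%VF.
have TW : (lker T <= walk_eigenspace G (- e))%VS.
  apply/subvP=> h; rewrite memv_ker comp_lfunE !lfunE /= => /eqP/ffunP h0.
  apply/walk_eigenspaceP=> u; have := h0 u; rewrite !ffunE.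
  rewrite (eq_bigr (fun d => k%:R * (h u + e * h (dtgt d)))); last first.
    move=> d /eqP du; rewrite (eq_bigr (fun=> h u + e * h (dtgt d))).
      by rewrite sumr_const card_ord mulr_natl.
    by move=> i _; rewrite ffunE du.
  rewrite -mulr_sumr big_split /= -mulr_sumr (sum_dart_src h) => /eqP.
  rewrite mulf_eq0 pnatr_eq0 -leqn0 leqNgt k_gt0 /= => /eqP.
  have -> : \sum_(d : dart G | dsrc d == u) h u = (degree u)%:R * h u.
    rewrite degree_sum_dart mulr_suml; apply: eq_bigr => d _.
    by rewrite mul1r.
  set A := \sum_(v | _) _ => E.
  have -> : A = e * (e * A) by rewrite mulrA -expr2 e2 mul1r.
  have -> : e * A = - ((degree u)%:R * h u) by apply/eqP; rewrite -addr_eq0 addrC E.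
  by ring.
rewrite -(dim_ffun G) -(limg_ker_dim T fullv) capfv addnC.
by rewrite leq_add ?dimvS // limg_comp limgS //; apply/subvP=> _ /memv_imgP[h _ ->];
  rewrite lfunE; apply: coboundary_twisted.
Qed.

Fact edge_of_subproof (d : dart G) : [set dsrc d; dtgt d] \in edges G.
Proof. by apply/imsetP; exists (val d); rewrite // inE; apply: (valP d). Qed.

Definition edge_of (d : dart G) : {x : {set G} | x \in edges G} :=
  Sub [set dsrc d; dtgt d] (edge_of_subproof d).

Lemma edge_of_surj x : exists d, edge_of d == x.
Proof.
case: x => x xE; have /imsetP[[u v]] := xE; rewrite inE /= => uv ex.
have [d du dv] := dart_of_adj uv.
by exists d; rewrite -val_eqE /= ex du dv.
Qed.

Lemma edge_of_rev d : edge_of (drev d) = edge_of d.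
Proof. by apply: val_inj; rewrite /= setUC. Qed.

Lemma dart_neq (d : dart G) : dsrc d != dtgt d.
Proof. by apply: contraTneq (adj_dart d) => ->; rewrite adj_irr. Qed.

Lemma edge_of_inj (d d' : dart G) : edge_of d = edge_of d' -> d = d' \/ d = drev d'.
Proof.
move=> /(congr1 val) /= /setP E.
have := E (dsrc d'); have := E (dtgt d'); have := E (dsrc d).
rewrite !inE !eqxx ?orbT /= => /esym/orP[]/eqP e.
  rewrite -e => /orP[/eqP f|/eqP f _].
    by have := dart_neq d'; rewrite f e eqxx.
  by left; apply: dart_eq.
move=> _ /orP[/eqP f|/eqP f].
  by have := dart_neq d'; rewrite f e eqxx.
by right; apply: dart_eq.
Qed.

(** A sign for each dart, taken from an arbitrary total order of the vertices; it
is itself multiplied by [e] under reversal, so that multiplication by it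
turns functions of the edges into twisted functions of the darts. *)
Definition orientation e (d : dart G) : R :=
  if (enum_rank (dsrc d) < enum_rank (dtgt d))%N then 1 else e.

Lemma orientation_rev e d : e ^+ 2 = 1 ->
  orientation e (drev d) = e * orientation e d.
Proof.
move=> e2; rewrite /orientation /=; have := dart_neq d.
rewrite -(inj_eq enum_rank_inj) -val_eqE.
by case: ltngtP => //= _ _; rewrite ?mulr1 // -expr2 e2.
Qed.

Lemma orientation_sqr e d : e ^+ 2 = 1 -> orientation e d ^+ 2 = 1.
Proof. by rewrite /orientation; case: ifP => // _ _; rewrite expr1n. Qed.

Lemma dim_twisted e : e ^+ 2 = 1 -> \dim (twisted e) = (k * graph_size G)%N.
Proof.
move=> e2; pose T := ({x : {set G} | x \in edges G} * 'I_k)%type.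
pose F (w : {ffun T -> R^o}) : {ffun dart G * 'I_k -> R^o} :=
  [ffun p => orientation e p.1 * w (edge_of p.1, p.2)].
have F_lin : linear F.
  by move=> c f g; apply/ffunP=> p; rewrite !ffunE /GRing.scale /=; ring.
pose FM := GRing.isLinear.Build R _ _ _ F F_lin.
pose FL : {linear {ffun T -> R^o} -> {ffun dart G * 'I_k -> R^o}} := HB.pack F FM.
have o0 d : orientation e d != 0.
  by rewrite -sqrf_eq0 orientation_sqr // oner_eq0.
rewrite (@dim_linear_bij _ _ _ FL fullv).
- by rewrite dim_ffun card_prod card_ord card_sig mulnC;
    congr (_ * _)%N; apply: eq_card.
- move=> w _ /ffunP w0; apply/ffunP=> -[x i].
  have [d /eqP <-] := edge_of_surj x; have := w0 (d, i); rewrite !ffunE => /eqP.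
  by rewrite mulf_eq0 (negPf (o0 d)) => /eqP.
- move=> w _; apply/twistedP=> d i; rewrite !ffunE edge_of_rev.
  by rewrite orientation_rev // mulrA.
- move=> g /twistedP ge; pose rep x := xchoose (edge_of_surj x).
  exists [ffun p => orientation e (rep p.1) * g (rep p.1, p.2)]; first exact: memvf.
  apply/ffunP=> -[d i]; rewrite !ffunE /= mulrA.
  (* the chosen representative is [d] itself or its reversal, and in the second
     case the two factors [e] cancel *)
  have /edge_of_inj[->|->] : edge_of (rep (edge_of d)) = edge_of d.
    by apply/eqP/(xchooseP (edge_of_surj _)).
    by rewrite -expr2 orientation_sqr // mul1r.
  have := orientation_sqr d e2; rewrite orientation_rev // ge => o2.
  by rewrite -[LHS]mul1r -[in LHS]o2; ring: e2.
Qed.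

Lemma dim_circulations e : e ^+ 2 = 1 -> (0 < k)%N ->
  (\dim (circulations e) + graph_order G)%N =
  (k * graph_size G + \dim (walk_eigenspace G (- e)))%N.
Proof.
move=> e2 k_gt0; rewrite /graph_order -(dim_boundary_twisted e2 k_gt0) addnA.
by rewrite limg_ker_dim dim_twisted.
Qed.

End Circulations.

(** * Eigenfunctions of the hexagonal graph *)

Section HexagonalEigenvectors.
Variables (R : rcfType) (G : sgraph) (k : nat).
Local Notation H := (khex k G).
Implicit Types (mu : R).

(** On the path leaving along the dart [d], [near] and [far] are the inner vertices
at distance 1 and 2 from the source; the other half of the path is named by
the reversed dart. *)
Definition old (u : G) : H := inl u.
Definition near (d : dart G) (i : 'I_k) : H := inr (d, i, false).
Definition far (d : dart G) (i : 'I_k) : H := inr (d, i, true).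

Lemma adj_old_old u v : adj (old u) (old v) = adj u v.
Proof. by rewrite /= /khex_adj /= [adj v u]adj_sym orbb. Qed.

Lemma adj_old_near u d i : adj (old u) (near d i) = (dsrc d == u).
Proof. by rewrite /= /khex_adj /= orbF eq_sym. Qed.

Lemma adj_old_far u d i : adj (old u) (far d i) = false.
Proof. by []. Qed.

Lemma adj_near_near d i d' i' : adj (near d i) (near d' i') = false.
Proof. by []. Qed.

Lemma adj_near_far d i d' i' :
  adj (near d i) (far d' i') = (d' == d) && (i' == i).
Proof. by rewrite /= /khex_adj /= orbF ![_ == d]eq_sym ![_ == i]eq_sym. Qed.

Lemma adj_far_far d i d' i' :
  adj (far d i) (far d' i') = (d' == drev d) && (i' == i).
Proof.
have H1 (a b : dart G) : (val b == ((val a).2, (val a).1)) = (b == drev a).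
  by rewrite -val_eqE.
rewrite /= /khex_adj /= !H1 -(inv_eq (@drevK G) d d').
by rewrite [drev d == _]eq_sym [i == _]eq_sym orbb.
Qed.

(** Every neighbourhood sum in [H] is computed from this decomposition. *)
Lemma sum_khex (V : zmodType) (F : H -> V) :
  \sum_x F x = \sum_u F (old u) + \sum_d \sum_i (F (near d i) + F (far d i)).
Proof.
rewrite big_sumType /=; congr (_ + _).
transitivity (\sum_d \sum_i \sum_b F (inr (d, i, b))).
  rewrite pair_bigA pair_bigA.
  by apply: eq_bigr => -[[d i] b] _.
apply: eq_bigr => d _; apply: eq_bigr => i _.
by rewrite big_bool addrC.
Qed.

Lemma sum_delta (V : zmodType) (F : dart G -> 'I_k -> V) d i :
  \sum_d' \sum_i' (if (d' == d) && (i' == i) then F d' i' else 0) = F d i.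
Proof.
rewrite (bigD1 d) //= [X in _ + X]big1 ?addr0; last first.
  by move=> d' /negPf->; rewrite big1.
rewrite (bigD1 i) //= !eqxx big1 ?addr0 //.
by move=> i' /negPf->; rewrite andbF.
Qed.

Lemma sum_adj_old (V : zmodType) (F : H -> V) u :
  \sum_(x | adj (old u) x) F x =
  \sum_(v | adj u v) F (old v) + \sum_(d | dsrc d == u) \sum_i F (near d i).
Proof.
rewrite big_mkcond sum_khex [in RHS]big_mkcond [X in _ = _ + X]big_mkcond.
congr (_ + _); first by apply: eq_bigr => v _; rewrite adj_old_old.
apply: eq_bigr => d _.
rewrite (eq_bigr (fun i => if dsrc d == u then F (near d i) else 0)).
  by case: ifP => // _; rewrite big1.
by move=> i _; rewrite adj_old_near adj_old_far addr0.
Qed.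

Lemma sum_adj_near (V : zmodType) (F : H -> V) d i :
  \sum_(x | adj (near d i) x) F x = F (old (dsrc d)) + F (far d i).
Proof.
rewrite big_mkcond sum_khex; congr (_ + _).
  by rewrite -big_mkcond (big_pred1 (dsrc d)).
rewrite -[F (far d i)](sum_delta (fun d i => F (far d i))).
apply: eq_bigr => d' _; apply: eq_bigr => i' _.
by rewrite adj_near_near adj_near_far add0r.
Qed.

Lemma sum_adj_far (V : zmodType) (F : H -> V) d i :
  \sum_(x | adj (far d i) x) F x = F (near d i) + F (far (drev d) i).
Proof.
rewrite big_mkcond sum_khex big1 ?add0r //.
rewrite -[F (near d i)](sum_delta (fun d i => F (near d i))).
rewrite -[F (far (drev d) i)](sum_delta (fun d i => F (far d i))).
rewrite -big_split; apply: eq_bigr => d' _; rewrite -big_split.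
apply: eq_bigr => i' _.
by rewrite adj_far_far adj_sym adj_near_far [d == _]eq_sym [i == _]eq_sym.
Qed.

Lemma degree_old u : (degree (old u))%:R = (k%:R + 1) * (degree u)%:R :> R.
Proof.
rewrite degree_sum sum_adj_old -degree_sum mulrDl mul1r addrC; congr (_ + _).
rewrite degree_sum_dart mulr_sumr; apply: eq_bigr => d _.
by rewrite sumr_const card_ord mulr1.
Qed.

Lemma degree_near d i : (degree (near d i))%:R = 2 :> R.
Proof. by rewrite degree_sum sum_adj_near. Qed.

Lemma degree_far d i : (degree (far d i))%:R = 2 :> R.
Proof. by rewrite degree_sum sum_adj_far. Qed.

Lemma khex_eigenP mu (f : {ffun H -> R^o}) :
  reflect
    [/\ forall u, \sum_(v | adj u v) f (old v) +
          \sum_(d | dsrc d == u) \sum_i f (near d i) =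
          (k%:R + 1) * mu * (degree u)%:R * f (old u),
        forall d i, f (old (dsrc d)) + f (far d i) = 2 * mu * f (near d i)
      & forall d i, f (near d i) + f (far (drev d) i) = 2 * mu * f (far d i)]
    (f \in walk_eigenspace H mu).
Proof.
apply: (iffP (walk_eigenspaceP _ _)) => [fW | [f1 f2 f3]].
  split=> [u | d i | d i].
  - by have := fW (old u); rewrite sum_adj_old degree_old => ->; ring.
  - by have := fW (near d i); rewrite sum_adj_near degree_near => ->; ring.
  - by have := fW (far d i); rewrite sum_adj_far degree_far => ->; ring.
case=> [u | [[d i] [|]]].
- by rewrite -/(old u) sum_adj_old degree_old f1; ring.
- by rewrite -/(far d i) sum_adj_far degree_far f3; ring.
- by rewrite -/(near d i) sum_adj_near degree_near f2; ring.
Qed.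

(** The Chebyshev polynomials of the second kind [U_4] and [U_3]. *)
Definition cheb4 mu := 16 * mu ^+ 4 - 12 * mu ^+ 2 + 1.
Definition cheb3 mu := 8 * mu ^+ 3 - 4 * mu.

(** Starting from the values at the source and at the first inner vertex, the path
equations determine the remaining values up to the target successively; this is
the Chebyshev recurrence. *)
Lemma near_of_ends mu (f : {ffun H -> R^o}) d i :
  f \in walk_eigenspace H mu ->
  cheb4 mu * f (near d i) = cheb3 mu * f (old (dsrc d)) + f (old (dtgt d)).
Proof.
case/khex_eigenP=> _ f2 f3.
have := f2 d i; have := f2 (drev d) i; have := f3 d i; have := f3 (drev d) i.
rewrite drevK -[dsrc (drev d)]/(dtgt d) /cheb3 /cheb4.
set a := f (near d i); set b := f (far d i); set a' := f (near _ i).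
set b' := f (far _ i); set x := f _; set y := f _ => e1 e2 e3 e4.
have eb : b = 2 * mu * a - y by rewrite -e4; ring.
have eb' : b' = 2 * mu * b - a by rewrite -e2; ring.
have ea' : a' = 2 * mu * b' - b by rewrite -e1; ring.
have -> : x = 2 * mu * a' - b' by rewrite -e3; ring.
by rewrite ea' eb' eb; ring.
Qed.

Lemma sum_dart_affine (a b : R) (x : G -> R) u :
  \sum_(d | dsrc d == u) (a * x u + b * x (dtgt d)) =
  a * (degree u)%:R * x u + b * \sum_(v | adj u v) x v.
Proof.
rewrite big_split /= -[X in _ + X]mulr_sumr sum_dart_src degree_sum_dart.
rewrite [a * \sum_(d | _) _]mulr_sumr mulr_suml; congr (_ + _).
apply: eq_bigr => d _.
by rewrite mulr1.
Qed.

(** Restriction to the old vertices is injective and has the stated image by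
[near_of_ends], whose formula also extends an eigenfunction of [G] to [H]. *)
Lemma dim_khex_generic mu theta :
  cheb4 mu != 0 -> cheb4 mu + k%:R != 0 ->
  (k%:R + 1) * mu * cheb4 mu - k%:R * cheb3 mu = (cheb4 mu + k%:R) * theta ->
  \dim (walk_eigenspace H mu) = \dim (walk_eigenspace G theta).
Proof.
move=> c0 ck0 mu_theta.
pose F (f : {ffun H -> R^o}) : {ffun G -> R^o} := [ffun u => f (old u)].
have F_lin : linear F by move=> c f g; apply/ffunP=> u; rewrite !ffunE.
pose FM := GRing.isLinear.Build R _ _ _ F F_lin.
pose FL : {linear {ffun H -> R^o} -> {ffun G -> R^o}} := HB.pack F FM.
apply/esym/(@dim_linear_bij _ _ _ FL).
- move=> f fW /ffunP f0; have fold u : f (old u) = 0.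
    by have := f0 u; rewrite !ffunE.
  have fnear d i : f (near d i) = 0.
    have /eqP := near_of_ends d i fW.
    by rewrite !fold mulr0 addr0 mulf_eq0 (negPf c0) => /eqP.
  have [_ f2 _] := khex_eigenP _ _ fW.
  apply/ffunP=> -[u|[[d i] [|]]]; rewrite [RHS]ffunE; [exact: fold | | exact: fnear].
  by have := f2 d i; rewrite fold fnear mulr0 add0r.
- move=> f fW; apply/walk_eigenspaceP=> u; apply: (mulfI ck0).
  pose x v : R := f (old v).
  rewrite ffunE (eq_bigr x) => [|v _]; last by rewrite ffunE.
  have [f1 _ _] := khex_eigenP _ _ fW.
  have E : cheb4 mu * \sum_(d | dsrc d == u) \sum_i f (near d i) =
      k%:R * cheb3 mu * (degree u)%:R * x u + k%:R * \sum_(v | adj u v) x v.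
    rewrite -sum_dart_affine mulr_sumr; apply: eq_bigr => d /eqP du.
    rewrite mulr_sumr (eq_bigr (fun=> cheb3 mu * x u + x (dtgt d))).
      by rewrite sumr_const card_ord -[LHS]mulr_natl; ring.
    by move=> i _; rewrite near_of_ends // du.
  have f1u := f1 u; rewrite -/(x u) in f1u.
  transitivity (cheb4 mu * ((k%:R + 1) * mu * (degree u)%:R * x u)
      - k%:R * cheb3 mu * (degree u)%:R * x u).
    by rewrite -f1u mulrDr E; ring.
  transitivity (((cheb4 mu + k%:R) * theta) * (degree u)%:R * x u).
    by rewrite -mu_theta; ring.
  by rewrite /x; ring.
- move=> h /walk_eigenspaceP hW.
  pose a (d : dart G) := (cheb3 mu * h (dsrc d) + h (dtgt d)) / cheb4 mu.
  pose f : {ffun H -> R^o} := [ffun x => match x with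
    | inl u => h u
    | inr (d, _, false) => a d
    | inr (d, _, true) => 2 * mu * a d - h (dsrc d)
    end].
  have fo u : f (old u) = h u by rewrite ffunE.
  have fn d i : f (near d i) = a d by rewrite ffunE.
  have ff d i : f (far d i) = 2 * mu * a d - h (dsrc d) by rewrite ffunE.
  exists f; last by apply/ffunP=> u; rewrite !ffunE.
  apply/khex_eigenP; split=> [u | d i | d i].
  + rewrite fo (eq_bigr h) => [|v _]; last exact: fo.
    rewrite (eq_bigr (fun d => k%:R * cheb3 mu / cheb4 mu * h u +
        k%:R / cheb4 mu * h (dtgt d))); last first.
      move=> d /eqP du; rewrite (eq_bigr (fun=> a d)) => [|i _]; last exact: fn.
      by rewrite sumr_const card_ord -[LHS]mulr_natl /a du; field.
    rewrite sum_dart_affine.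
    rewrite hW; apply: (mulfI c0).
    transitivity (((cheb4 mu + k%:R) * theta + k%:R * cheb3 mu)
        * (degree u)%:R * h u).
      by field.
    by rewrite -mu_theta; ring.
  + by rewrite fo fn ff; ring.
  + rewrite fn !ff /a -[dsrc (drev d)]/(dtgt d) -[dtgt (drev d)]/(dsrc d).
    by move: c0; rewrite /cheb3 /cheb4 => c0; field.
Qed.

(** The hypothesis on [mu] says that [mu] is a zero of [U_4] with [U_3 mu = e].
Let [x] be the values at the old vertices.  The path equations force [x] to
change by the factor [- e] along each edge, and subtracting [mu * x] from the
near values leaves a twisted function whose boundary is [(mu + e) * deg * x];
pairing it with [x] gives [x = 0]. *)
Lemma dim_khex_exceptional mu e : e ^+ 2 = 1 -> 4 * mu ^+ 2 - 1 = 2 * e * mu ->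
  (0 < k)%N -> (forall u : G, (0 < degree u)%N) ->
  \dim (walk_eigenspace H mu) = \dim (circulations G k e).
Proof.
move=> e2 mue k_gt0 deg_gt0.
pose F (g : {ffun dart G * 'I_k -> R^o}) : {ffun H -> R^o} := [ffun x => match x with
    | inl u => 0
    | inr (d, i, false) => g (d, i)
    | inr (d, i, true) => 2 * mu * g (d, i)
    end].
have F_lin : linear F.
  move=> c f g; apply/ffunP=> -[u|[[d i] [|]]];
    by rewrite !ffunE //= /GRing.scale /=; ring.
pose FM := GRing.isLinear.Build R _ _ _ F F_lin.
pose FL : {linear {ffun dart G * 'I_k -> R^o} -> {ffun H -> R^o}} := HB.pack F FM.
have Fo g u : F g (old u) = 0 by rewrite ffunE.
have Fn g d i : F g (near d i) = g (d, i) by rewrite ffunE.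
have Ff g d i : F g (far d i) = 2 * mu * g (d, i) by rewrite ffunE.
apply: (@dim_linear_bij _ _ _ FL).
- move=> g _ /ffunP g0; apply/ffunP=> -[d i].
  by have := g0 (near d i); rewrite /= Fn !ffunE.
- move=> g /circulationsP[ge gb]; apply/khex_eigenP; split=> [u | d i | d i] /=.
  + rewrite Fo mulr0 big1 ?add0r => [|v _]; last exact: Fo.
    rewrite -[RHS](gb u); apply: eq_bigr => d _; apply: eq_bigr => i _; exact: Fn.
  + by rewrite Fo Fn Ff add0r.
  + rewrite Fn !Ff ge; transitivity ((4 * mu ^+ 2 - 1) * g (d, i) + g (d, i)).
      by rewrite mue; ring.
    by ring.
- move=> f fW; have [f1 f2 f3] := khex_eigenP _ _ fW.
  pose x u := f (old u).
  have [nearrev xtgt] : (forall d i, f (near (drev d) i) =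
      e * (f (near d i) - 2 * mu * x (dsrc d))) /\
      (forall d (i : 'I_k), x (dtgt d) = - e * x (dsrc d)).
    suff S d i : f (near (drev d) i) = e * (f (near d i) - 2 * mu * x (dsrc d))
      /\ x (dtgt d) = - e * x (dsrc d) by split=> d i; case: (S d i).
    have := f2 d i; have := f2 (drev d) i; have := f3 d i; have := f3 (drev d) i.
    rewrite drevK -[dsrc (drev d)]/(dtgt d) -!/(x _).
    move: (f (near d i)) (f (far d i)) => a b.
    move: (f (near (drev d) i)) (f (far (drev d) i)) => a' b'.
    move: (x (dtgt d)) (x (dsrc d)) => z y e1 e2' e3 e4.
    (* the values further along the path are eliminated one after the other,
       the powers of [mu] being reduced by [sq] *)
    have sq : 4 * mu ^+ 2 = 1 + 2 * e * mu by rewrite -mue; ring.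
    have eb : b = 2 * mu * a - y by rewrite -e4; ring.
    have eb' : b' = 2 * mu * b - a by rewrite -e2'; ring.
    have ea' : a' = 2 * mu * b' - b by rewrite -e1; ring.
    have ez : z = 2 * mu * a' - b' by rewrite -e3; ring.
    have eb2 : b' = 2 * e * mu * a - 2 * mu * y.
      transitivity (4 * mu ^+ 2 * a - a - 2 * mu * y); first by rewrite eb' eb; ring.
      by rewrite sq; ring.
    have ea2 : a' = e * (a - 2 * mu * y).
      transitivity (4 * mu ^+ 2 * (e * a - y) - 2 * mu * a + y).
        by rewrite ea' eb eb2; ring.
      by rewrite sq; ring: e2.
    split=> //; rewrite ez ea2 eb2.
    transitivity (- (4 * mu ^+ 2) * e * y + 2 * mu * y); first by ring.
    by rewrite sq; ring: e2.
  pose h : {ffun G -> R^o} := [ffun u => x u].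
  pose g : {ffun dart G * 'I_k -> R^o} :=
    [ffun p => f (near p.1 p.2) - mu * x (dsrc p.1)].
  have hW : h \in walk_eigenspace G (- e).
    apply/(walk_eigenspace_sign _ e2) => u v.
    rewrite adj_sym => /dart_of_adj[d <- <-].
    by rewrite !ffunE; apply: xtgt (Ordinal k_gt0).
  have gT : g \in twisted G k e.
    apply/twistedP=> d i.
    by rewrite !ffunE /= nearrev -[dsrc (drev d)]/(dtgt d) (xtgt d i); ring.
  have gB u : boundary g u = (mu + e) * ((degree u)%:R * x u).
    rewrite ffunE.
    have : \sum_(d | dsrc d == u) \sum_i f (near d i) =
        ((k%:R + 1) * mu + e) * (degree u)%:R * x u.
      have := f1 u; have /walk_eigenspaceP/(_ u) := hW.
      rewrite ffunE; under eq_bigr do rewrite ffunE.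
      by rewrite -/(x u) /x => -> E; rewrite mulrDl mulrDl -E; ring.
    have -> : \sum_(d | dsrc d == u) \sum_i f (near d i) =
        \sum_(d | dsrc d == u)
          (\sum_i g (d, i) + (k%:R * mu * x u + 0 * x (dtgt d))).
      apply: eq_bigr => d /eqP du; rewrite mul0r addr0.
      rewrite -[k%:R * _ * _]mulrA mulr_natl -[X in _ *+ X](card_ord k).
      rewrite -sumr_const -big_split.
      by apply: eq_bigr => i _; rewrite ffunE /= du subrK.
    rewrite big_split /= sum_dart_affine mul0r addr0 => E.
    apply: (addIr (k%:R * mu * (degree u)%:R * x u)).
    by rewrite E; ring.
  have mue0 : mu + e != 0.
    rewrite addr_eq0; apply/eqP=> mu_e; move: mue; rewrite mu_e sqrrN e2.
    have -> : 2 * e * - e = - 2 * e ^+ 2 by ring.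
    by rewrite e2; lra.
  have x0 u : x u = 0.
    have := boundary_orthogonal e2 gT hW.
    rewrite (eq_bigr (fun u => (mu + e) * ((degree u)%:R * x u ^+ 2))); last first.
      by move=> v _; rewrite gB ffunE; ring.
    rewrite -mulr_sumr => /eqP; rewrite mulf_eq0 (negPf mue0) => /eqP/psumr_eq0P H.
    have /eqP : (degree u)%:R * x u ^+ 2 = 0.
      by apply: H => // v _; rewrite mulr_ge0 ?ler0n ?sqr_ge0.
    by rewrite mulf_eq0 pnatr_eq0 -leqn0 leqNgt deg_gt0 sqrf_eq0 => /eqP.
  exists [ffun p => f (near p.1 p.2)].
    apply/circulationsP; split=> [d i|u].
      by rewrite !ffunE /= nearrev x0; ring.
    have := f1 u; rewrite -/(x u) x0 mulr0 big1 ?add0r => [E|v _]; last exact: x0.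
    rewrite -[RHS]E; by apply: eq_bigr => d _; apply: eq_bigr => i _; rewrite ffunE.
  apply/ffunP=> -[u|[[d i] [|]]]; rewrite ffunE ?ffunE //=; first exact: x0.
  by rewrite -f2 -/(x _) x0 add0r.
Qed.

End HexagonalEigenvectors.

(** * The hexagonal graph and its quintic *)

Definition has_edge (G : sgraph) : Prop := exists x y : G, adj x y.

Lemma degree_gt0 (G : sgraph) : connected G -> has_edge G ->
  forall u : G, (0 < degree u)%N.
Proof.
move=> conn [x [y xy]] u; apply/card_gt0P.
have /connectP[[|w p] /= pth e] := conn u x.
  by exists y; rewrite inE -e.
by exists w; rewrite inE; case/andP: pth.
Qed.

Section HexagonalGraph.
Variables (k : nat) (G : sgraph).

Lemma khex_connected : connected G -> connected (khex k G).
Proof.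
move=> conn.
have csym : connect_sym (@adj (khex k G)).
  by apply: sym_connect_sym; apply: adj_sym.
have old_conn (u v : G) : connect (@adj (khex k G)) (old k u) (old k v).
  have /connectP[p pth ->] := conn u v.
  elim: p u pth => //= w p IH u /andP[uw /IH]; apply: connect_trans.
  apply: connect1.
  by rewrite -[X in is_true X]/(adj (old k u) (old k w)) adj_old_old.
have to_old (x : khex k G) : exists u, connect (@adj (khex k G)) x (old k u).
  have near_old d (i : 'I_k) : connect (@adj (khex k G)) (near d i) (old k (dsrc d)).
    by apply: connect1; rewrite adj_sym adj_old_near.
  case: x => [u|[[d i] [|]]]; first by exists u.
    exists (dsrc d); apply: connect_trans (near_old d i).
    by apply: connect1; rewrite adj_sym -/(near d i) -/(far d i) adj_near_far !eqxx.
  by exists (dsrc d); apply: near_old.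
move=> x y; have [u xu] := to_old x; have [v yv] := to_old y.
by apply: connect_trans xu (connect_trans (old_conn u v) _); rewrite csym.
Qed.

Lemma khex_has_edge : has_edge G -> has_edge (khex k G).
Proof. by case=> x [y xy]; exists (old k x), (old k y); rewrite adj_old_old. Qed.

(** The added paths have odd length, so a proper 2-colouring of their ends can be
continued alternately along them. *)
Lemma khex_bipartite : bipartite (khex k G) <-> bipartite G.
Proof.
split=> -[c cP].
  by exists (fun u => c (old k u)) => u v uv; apply: cP; rewrite adj_old_old.
pose C (x : khex k G) := match x with
  | inl u => c u
  | inr (d, _, b) => if b then c (dsrc d) else ~~ c (dsrc d)
  end.
have arcP (x y : khex k G) : khex_arc x y -> C x != C y.
  case: x y => [u|[[d i] [|]]] [v|[[d' i'] [|]]] //=.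
  - exact: cP.
  - by move/eqP->; case: (c _).
  - case/andP=> /eqP e _; have -> : dsrc d' = dtgt d by rewrite /dsrc /= e.
    exact: cP (adj_dart d).
  - by case/andP=> /eqP-> _; case: (c _).
exists C => x y /orP[/arcP //|/arcP]; by rewrite eq_sym.
Qed.

End HexagonalGraph.

Section Iteration.
Variables (k : nat) (G : sgraph).

Lemma khex_iter_connected n : connected G -> connected (khex_iter k n G).
Proof. by move=> conn; elim: n => //= n; apply: khex_connected. Qed.

Lemma khex_iter_has_edge n : has_edge G -> has_edge (khex_iter k n G).
Proof. by move=> E; elim: n => //= n; apply: khex_has_edge. Qed.

Lemma khex_iter_bipartite n : bipartite (khex_iter k n G) <-> bipartite G.
Proof. by elim: n => //= n IH; rewrite khex_bipartite. Qed.

End Iteration.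

Section Quintic.
Variables (R : rcfType) (k : nat).
Local Notation K := (k%:R : R).
Implicit Types (mu s x e : R).

(** The quintic vanishes exactly when [mu = 1 - x] and [theta = 1 - s] satisfy the
relation under which [dim_khex_generic] applies. *)
Lemma khex_quinticE s x :
  (khex_quintic k s).[x] =
  (cheb4 (1 - x) + K) * (1 - s) -
  ((K + 1) * (1 - x) * cheb4 (1 - x) - K * cheb3 (1 - x)).
Proof.
rewrite /khex_quintic /= !(hornerD, hornerN, hornerZ, hornerXn, hornerX, hornerC).
by rewrite /cheb4 /cheb3; ring.
Qed.

Lemma root_khex_quintic s x :
  root (khex_quintic k s) x =
  ((K + 1) * (1 - x) * cheb4 (1 - x) - K * cheb3 (1 - x) ==
   (cheb4 (1 - x) + K) * (1 - s)).
Proof. by rewrite rootE khex_quinticE subr_eq0 eq_sym. Qed.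

Lemma cheb_exceptional mu e : e ^+ 2 = 1 -> 4 * mu ^+ 2 - 1 = 2 * e * mu ->
  cheb4 mu = 0 /\ cheb3 mu = e.
Proof.
move=> e2 mue; split.
  transitivity ((4 * mu ^+ 2 - 1) ^+ 2 - 4 * mu ^+ 2); first by rewrite /cheb4; ring.
  by rewrite mue; ring: e2.
transitivity (2 * mu * ((4 * mu ^+ 2 - 1) - 1)); first by rewrite /cheb3; ring.
rewrite mue; transitivity (e * (4 * mu ^+ 2 - 1 + 1) - 2 * mu); first by ring.
by rewrite mue; ring: e2.
Qed.

(** [U_4 = (4 mu^2 - 1)^2 - (2 mu)^2] is a difference of squares. *)
Lemma cheb4_eq0 mu : cheb4 mu = 0 ->
  exists2 e, e ^+ 2 = 1 & 4 * mu ^+ 2 - 1 = 2 * e * mu.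
Proof.
move=> c0; have /eqP : (4 * mu ^+ 2 - 1) ^+ 2 = (2 * mu) ^+ 2.
  by apply/eqP; rewrite -subr_eq0 -c0 /cheb4; apply/eqP; ring.
rewrite eqf_sqr => /orP[]/eqP->; [exists 1|exists (-1)];
  rewrite ?sqrrN ?expr1n //; ring.
Qed.

Lemma cheb4D_neq0 mu : (2 <= k)%N -> cheb4 mu + K != 0.
Proof.
move=> k2; have K2 : 2 <= K by rewrite (ler_nat R 2 k).
apply: lt0r_neq0; have := sqr_ge0 (4 * mu ^+ 2 - 3 / 2).
(* [(4 mu^2 - 3/2)^2 - 5/4] completes the square in [U_4] *)
rewrite /cheb4 => h; have -> : 16 * mu ^+ 4 - 12 * mu ^+ 2 + 1 + K =
  (4 * mu ^+ 2 - 3 / 2) ^+ 2 + (K - 5 / 4) by field.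
lra.
Qed.

Lemma poly_ivt_strict (p : {poly R}) a b : a < b -> p.[a] * p.[b] < 0 ->
  exists2 x, a < x < b & root p x.
Proof.
move=> ab pab.
have [x /andP[ax xb] px] : exists2 x, a <= x <= b & root p x.
  have [pa|pa] := leP p.[a] 0.
    by apply: poly_ivt (ltW ab) _; rewrite pa; nra.
  have [|x xab] := @poly_ivt _ (- p) _ _ (ltW ab); first by rewrite !hornerE; nra.
  by rewrite rootN; exists x.
exists x => //; rewrite !lt_neqAle ax xb !andbT; apply/andP; split.
  by apply: contraTneq pab => ->; rewrite (rootP px) mul0r ltxx.
by apply: contraTneq pab => <-; rewrite (rootP px) mulr0 ltxx.
Qed.

Lemma khex_quintic_size s : size (khex_quintic k s) = 6%N /\
  lead_coef (khex_quintic k s) = 16 * K + 16.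
Proof.
pose c := [:: - (s * (K + 5)); 25 * K + 5 + 40 * s; - (100 * K + 40 + 84 * s);
  140 * K + 84 + 64 * s; - (80 * K + 64 + 16 * s); 16 * K + 16].
have -> : khex_quintic k s = \poly_(i < 6) c`_i.
  apply/polyP=> i; rewrite /khex_quintic !coefE.
  by do 6?[case: i => [|i] /=; first by ring]; ring.
have K0 : 16 * K + 16 != 0 by apply: lt0r_neq0; have := ler0n R k; lra.
by rewrite lead_coef_poly // size_poly_eq.
Qed.

(** Evaluating at [0], at the four zeros of [U_4] and at [2] gives six values with
alternating signs, since at a zero of [U_4] the quintic equals
[k * (e + 1 - s)]. *)
Lemma khex_quintic_split s : (0 < k)%N -> 0 < s < 2 ->
  exists lam : 5.-tuple R,
    khex_quintic k s = (16 * K + 16) *: \prod_(x <- lam) ('X - x%:P).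
Proof.
move=> k0 /andP[s0 s2]; set p := khex_quintic k s.
have K0 : 0 < K by rewrite ltr0n.
pose r : R := Num.sqrt 5.
have r2 : r ^+ 2 = 5 by rewrite sqr_sqrtr // ler0n.
have r0 : 0 <= r by apply: sqrtr_ge0.
have r_gt : 2 < r by rewrite ltNge; apply/negP=> ?; nra.
have r_lt : r < 3 by rewrite ltNge; apply/negP=> ?; nra.
have pE e x : e ^+ 2 = 1 -> 4 * (1 - x) ^+ 2 - 1 = 2 * e * (1 - x) ->
    p.[x] = K * (e + 1 - s).
  by move=> e2 /(cheb_exceptional e2)[c4 c3]; rewrite khex_quinticE c4 c3; ring.
have p0 : p.[0] = - ((K + 5) * s).
  by rewrite khex_quinticE /cheb4 /cheb3; ring.
have p1 : p.[(3 - r) / 4] = K * (2 - s).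
  by rewrite (pE 1); [ring | rewrite expr1n | field: r2].
have p2 : p.[(5 - r) / 4] = - (K * s).
  by rewrite (pE (-1)); [ring | rewrite sqrrN expr1n | field: r2].
have p3 : p.[(3 + r) / 4] = K * (2 - s).
  by rewrite (pE 1); [ring | rewrite expr1n | field: r2].
have p4 : p.[(5 + r) / 4] = - (K * s).
  by rewrite (pE (-1)); [ring | rewrite sqrrN expr1n | field: r2].
have p5 : p.[2] = (K + 5) * (2 - s).
  by rewrite khex_quinticE /cheb4 /cheb3; ring.
have A0 : 0 < K * s by nra.
have A1 : 0 < K * (2 - s) by nra.
have [x1 I1 R1] : exists2 x, 0 < x < (3 - r) / 4 & root p x.
  by apply: poly_ivt_strict; rewrite ?p0 ?p1; nra.
have [x2 I2 R2] : exists2 x, (3 - r) / 4 < x < (5 - r) / 4 & root p x.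
  by apply: poly_ivt_strict; rewrite ?p1 ?p2; nra.
have [x3 I3 R3] : exists2 x, (5 - r) / 4 < x < (3 + r) / 4 & root p x.
  by apply: poly_ivt_strict; rewrite ?p2 ?p3; nra.
have [x4 I4 R4] : exists2 x, (3 + r) / 4 < x < (5 + r) / 4 & root p x.
  by apply: poly_ivt_strict; rewrite ?p3 ?p4; nra.
have [x5 I5 R5] : exists2 x, (5 + r) / 4 < x < 2 & root p x.
  by apply: poly_ivt_strict; rewrite ?p4 ?p5; nra.
exists [tuple x1; x2; x3; x4; x5].
have [sz <-] := khex_quintic_size s.
apply: all_roots_prod_XsubC; first by rewrite sz.
  by rewrite /= R1 R2 R3 R4 R5.
rewrite uniq_rootsE; apply: (sorted_uniq lt_trans ltxx).
by rewrite /= andbT; apply/and4P; split; lra.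
Qed.

End Quintic.

(** * The spectrum of one hexagonal step *)

Section OneStep.
Variables (R : rcfType) (k : nat) (G : sgraph).
Hypotheses (conn : connected G) (edgeG : has_edge G) (k_ge2 : (2 <= k)%N).
Local Notation K := (k%:R : R).
Local Notation L := (normalized_laplacian R G).
Local Notation LH := (normalized_laplacian R (khex k G)).
Let r : R := Num.sqrt (5 * K ^+ 2 + 6 * K + 5).
Let r5 : R := Num.sqrt 5.
Implicit Types s x m e : R.

Fact K_ge2 : 2 <= K. Proof. by rewrite (ler_nat R 2 k). Qed.

Fact deg_gt0 : forall u : G, (0 < degree u)%N.
Proof. exact: degree_gt0. Qed.

Fact degH_gt0 : forall x : khex k G, (0 < degree x)%N.
Proof. exact: degree_gt0 (khex_connected conn) (khex_has_edge k edgeG). Qed.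

#[local] Hint Resolve deg_gt0 degH_gt0 : core.

Fact r_sqr : r ^+ 2 = 5 * K ^+ 2 + 6 * K + 5.
Proof. by rewrite sqr_sqrtr //; have := K_ge2; nra. Qed.

Fact r5_sqr : r5 ^+ 2 = 5.
Proof. by rewrite sqr_sqrtr // ler0n. Qed.

Lemma eigenvalue_bound s : eigenvalue L s -> 0 <= s <= 2.
Proof.
rewrite eigenvalue_walk; last exact: deg_gt0.
by move=> /(walk_eigenvalue_bound deg_gt0); lra.
Qed.

Lemma mult_khex_root s x : cheb4 (1 - x) != 0 ->
  root (khex_quintic k s) x -> mult LH x = mult L s.
Proof.
move=> c0; rewrite root_khex_quintic => /eqP e.
by rewrite !mult_walk // (dim_khex_generic G c0 (cheb4D_neq0 _ k_ge2) e).
Qed.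

(** The elimination behind the quintic fails at the zeros of [U_4]; they are roots
of it only for the two extreme eigenvalues. *)
Lemma khex_quintic_root_exceptional s x : cheb4 (1 - x) = 0 ->
  root (khex_quintic k s) x -> s = 0 \/ s = 2.
Proof.
case/cheb4_eq0=> e e2 mue; have [c4 c3] := cheb_exceptional e2 mue.
rewrite rootE khex_quinticE c4 c3 => /eqP E.
have {E} /eqP : K * (1 + e - s) = 0 by rewrite -E; ring.
rewrite mulf_eq0 => /orP[/eqP|]; first by have := K_ge2; lra.
rewrite subr_eq0 => /eqP <-.
have /eqP : e ^+ 2 = 1 ^+ 2 by rewrite e2 expr1n.
by rewrite eqf_sqr => /orP[]/eqP->; [right|left]; lra.
Qed.

Lemma mult0 : mult L 0 = 1%N.
Proof.
have [u0 _] := edgeG; rewrite mult_walk // subr0 -[1]opprK.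
apply: (@dim_walk_eigenspace_sgn _ _ _ (fun=> 1) u0) => //.
- by rewrite sqrrN expr1n.
- by move=> u; rewrite expr1n.
- by move=> u v _; rewrite opprK mulr1.
Qed.

Lemma mult2 : bipartite G -> mult L 2 = 1%N.
Proof.
case=> c cP; have [u0 _] := edgeG; rewrite mult_walk //.
have -> : 1 - 2 = -1 :> R by ring.
apply: (@dim_walk_eigenspace_sgn _ _ _ (fun u => (-1) ^+ c u) u0) => //.
- by rewrite expr1n.
- by move=> u; rewrite sqrr_sign.
- by move=> u v /cP; case: (c u); case: (c v) => //= _; rewrite ?expr0 ?expr1; ring.
Qed.

Lemma mult2_nonbipartite : ~ bipartite G -> mult L 2 = 0%N.
Proof.
move=> nb; apply/eqP; rewrite mult_walk // dimv_eq0.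
have -> : 1 - 2 = -1 :> R by ring.
by apply/negPn/negP=> /(bipartite_of_walk conn).
Qed.

(** The factor of the quintic for [s = 0], in terms of [m = 1 - x], that is left
after removing the root [m = 1] and the two zeros of [U_4] with [e = -1].
The symmetry [m -> - m] exchanges the cases [s = 0] and [s = 2]. *)
Definition sigma0_quadratic (m : R) :=
  4 * (K + 1) * m ^+ 2 + 2 * (K - 1) * m - (K + 1).

Lemma khex_quintic0 x : (khex_quintic k 0).[x] =
  - ((1 - x) - 1) * (4 * (1 - x) ^+ 2 + 2 * (1 - x) - 1)
  * sigma0_quadratic (1 - x).
Proof. by rewrite khex_quinticE /cheb4 /cheb3 /sigma0_quadratic; ring. Qed.

Lemma khex_quintic2 x : (khex_quintic k 2).[x] =
  - ((1 - x) + 1) * (4 * (1 - x) ^+ 2 - 2 * (1 - x) - 1)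
  * sigma0_quadratic (- (1 - x)).
Proof. by rewrite khex_quinticE /cheb4 /cheb3 /sigma0_quadratic; ring. Qed.

Lemma cheb4_factor (m : R) :
  cheb4 m = (4 * m ^+ 2 + 2 * m - 1) * (4 * m ^+ 2 - 2 * m - 1).
Proof. by rewrite /cheb4; ring. Qed.

(** A common zero with either factor of [U_4] would have to be [m = 0], where
neither factor vanishes. *)
Lemma sigma0_quadratic_cheb4 m : sigma0_quadratic m = 0 -> cheb4 m != 0.
Proof.
rewrite /sigma0_quadratic => q0; rewrite cheb4_factor.
apply/negP; rewrite mulf_eq0 => /orP[]/eqP h.
  have m0 : m = 0.
    have : 4 * m = 0.
      transitivity ((K + 1) * (4 * m ^+ 2 + 2 * m - 1) -
        (4 * (K + 1) * m ^+ 2 + 2 * (K - 1) * m - (K + 1))); first by ring.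
      by rewrite h q0; ring.
    by lra.
  by move: h; rewrite m0 expr0n /=; lra.
have m0 : m = 0.
  have : 4 * K * m = 0.
    transitivity ((4 * (K + 1) * m ^+ 2 + 2 * (K - 1) * m - (K + 1))
      - (K + 1) * (4 * m ^+ 2 - 2 * m - 1)); first by ring.
    by rewrite h q0; ring.
  by move/eqP; rewrite mulf_eq0 => /orP[]/eqP; [have := K_ge2; lra|].
by move: h; rewrite m0 expr0n /=; lra.
Qed.

Lemma cheb4N (m : R) : cheb4 (- m) = cheb4 m.
Proof. by rewrite /cheb4; ring. Qed.

Fact K1 : K + 1 != 0. Proof. by apply: lt0r_neq0; have := K_ge2; lra. Qed.

Lemma sigma0_quadratic_roots m : (sigma0_quadratic m == 0) =
  (m == (1 - K - r) / (4 * (K + 1))) || (m == (1 - K + r) / (4 * (K + 1))).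
Proof.
have -> : sigma0_quadratic m = 4 * (K + 1) *
   (m - (1 - K - r) / (4 * (K + 1))) * (m - (1 - K + r) / (4 * (K + 1))).
  by rewrite /sigma0_quadratic; field: r_sqr; exact: K1.
rewrite !mulf_eq0 (negPf K1) pnatr_eq0 /= !subr_eq0 //.
Qed.

Lemma one_minus_eq (a b x : R) : 1 - a = b -> (1 - x == b) = (x == a).
Proof. by move=> <-; rewrite (inj_eq (addrI 1)) (inj_eq oppr_inj). Qed.

Lemma sigma0_quadratic_pos_roots x : (sigma0_quadratic (1 - x) == 0) =
  (x \in [:: (5 * K + 3 - r) / (4 * (K + 1)); (5 * K + 3 + r) / (4 * (K + 1))]).
Proof.
rewrite sigma0_quadratic_roots !inE orbC.
by congr (_ || _); apply: one_minus_eq; field; exact: K1.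
Qed.

Lemma sigma0_quadratic_neg_roots x : (sigma0_quadratic (- (1 - x)) == 0) =
  (x \in [:: (3 * K + 5 - r) / (4 * (K + 1)); (3 * K + 5 + r) / (4 * (K + 1))]).
Proof.
rewrite sigma0_quadratic_roots !inE ![- _ == _]eqr_oppLR.
by congr (_ || _); apply: one_minus_eq; field; exact: K1.
Qed.

Lemma mult_khex_sigma0 x :
  x \in [:: 0; (5 * K + 3 - r) / (4 * (K + 1)); (5 * K + 3 + r) / (4 * (K + 1))] ->
  mult LH x = 1%N.
Proof.
rewrite in_cons => xl; rewrite (@mult_khex_root 0) ?mult0 //.
  case/orP: xl => [/eqP->|].
    by rewrite /cheb4; apply: lt0r_neq0; lra.
  by rewrite -sigma0_quadratic_pos_roots => /eqP/sigma0_quadratic_cheb4.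
rewrite rootE khex_quintic0; case/orP: xl => [/eqP->|].
  by apply/eqP; ring.
by rewrite -sigma0_quadratic_pos_roots => /eqP->; rewrite mulr0.
Qed.

Lemma mult_khex_sigma2 x : bipartite G ->
  x \in [:: 2; (3 * K + 5 - r) / (4 * (K + 1)); (3 * K + 5 + r) / (4 * (K + 1))] ->
  mult LH x = 1%N.
Proof.
move=> bip; rewrite in_cons => xl; rewrite (@mult_khex_root 2) ?mult2 //.
  case/orP: xl => [/eqP->|].
    by rewrite /cheb4; apply: lt0r_neq0; lra.
  rewrite -sigma0_quadratic_neg_roots => /eqP/sigma0_quadratic_cheb4.
  by rewrite cheb4N.
rewrite rootE khex_quintic2; case/orP: xl => [/eqP->|].
  by apply/eqP; ring.
by rewrite -sigma0_quadratic_neg_roots => /eqP->; rewrite mulr0.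
Qed.

Lemma mult_khex_exceptional e x : e ^+ 2 = 1 ->
  4 * (1 - x) ^+ 2 - 1 = 2 * e * (1 - x) ->
  (mult LH x + graph_order G)%N = (k * graph_size G + mult L (1 + e))%N.
Proof.
move=> e2 mue; have k0 : (0 < k)%N by apply: leq_trans k_ge2.
rewrite !mult_walk // (dim_khex_exceptional e2 mue) //.
by rewrite dim_circulations //; congr (_ + \dim (walk_eigenspace _ _))%N; ring.
Qed.

Lemma mult_khex_five x : x \in [:: (5 - r5) / 4; (5 + r5) / 4] ->
  (mult LH x + graph_order G)%N = (k * graph_size G + 1)%N.
Proof.
move=> xl; rewrite (@mult_khex_exceptional (-1)) ?subrr ?mult0 //.
  by rewrite sqrrN expr1n.
by move: xl; rewrite !inE => /orP[]/eqP->; field: r5_sqr.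
Qed.

Lemma mult_khex_three x : x \in [:: (3 - r5) / 4; (3 + r5) / 4] ->
  (mult LH x + graph_order G)%N = (k * graph_size G + mult L 2)%N.
Proof.
move=> xl; rewrite (@mult_khex_exceptional 1) ?expr1n //.
by move: xl; rewrite !inE => /orP[]/eqP->; field: r5_sqr.
Qed.

Lemma exceptional_list x : cheb4 (1 - x) = 0 ->
  x \in [:: (5 - r5) / 4; (5 + r5) / 4; (3 - r5) / 4; (3 + r5) / 4].
Proof.
rewrite cheb4_factor !inE => /eqP; rewrite mulf_eq0 => /orP[]/eqP h.
  have : (x - (5 - r5) / 4) * (x - (5 + r5) / 4) = 0.
    transitivity ((4 * (1 - x) ^+ 2 + 2 * (1 - x) - 1) / 4); first by field: r5_sqr.
    by rewrite h mul0r.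
  by move/eqP; rewrite mulf_eq0 !subr_eq0 => /orP[]->; rewrite ?orbT.
have : (x - (3 - r5) / 4) * (x - (3 + r5) / 4) = 0.
  transitivity ((4 * (1 - x) ^+ 2 - 2 * (1 - x) - 1) / 4); first by field: r5_sqr.
  by rewrite h mul0r.
by move/eqP; rewrite mulf_eq0 !subr_eq0 => /orP[]->; rewrite ?orbT.
Qed.

Lemma khex_eigenvalues_lift s : eigenvalue L s -> s != 0 -> s != 2 ->
  exists lam : 5.-tuple R,
    khex_quintic k s = (16 * K + 16) *: \prod_(x <- lam) ('X - x%:P) /\
    (forall i : 'I_5, eigenvalue LH (tnth lam i) /\
                      mult LH (tnth lam i) = mult L s).
Proof.
move=> Es s0 s2; have /andP[s_ge s_le] := eigenvalue_bound Es.
have sI : 0 < s < 2 by rewrite !lt_neqAle eq_sym s0 s2 s_ge s_le.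
have [lam lamE] := @khex_quintic_split R k s (ltnW k_ge2) sI.
exists lam; split=> // i.
have rt : root (khex_quintic k s) (tnth lam i).
  rewrite lamE rootZ; last by apply: lt0r_neq0; have := K_ge2; lra.
  by rewrite root_prod_XsubC mem_tnth.
have c0 : cheb4 (1 - tnth lam i) != 0.
  apply/eqP=> c0; have [e|e] := khex_quintic_root_exceptional c0 rt.
    by rewrite e eqxx in s0.
  by rewrite e eqxx in s2.
by rewrite !eigenvalue_mult // (mult_khex_root c0 rt) -eigenvalue_mult.
Qed.

(** Outside the zeros of [U_4] the quintic relation can be solved for [s], and the
solution is an eigenvalue of [G] because the two multiplicities agree. *)
Lemma khex_eigenvalue_cases x : eigenvalue LH x ->
  [\/ exists s : R, [/\ eigenvalue L s, s != 0, s != 2 & root (khex_quintic k s) x],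
      x \in [:: 0; (5 * K + 3 - r) / (4 * (K + 1)); (5 * K + 3 + r) / (4 * (K + 1))],
      bipartite G /\
      x \in [:: 2; (3 * K + 5 - r) / (4 * (K + 1)); (3 * K + 5 + r) / (4 * (K + 1))]
    | x \in [:: (5 - r5) / 4; (5 + r5) / 4; (3 - r5) / 4; (3 + r5) / 4]].
Proof.
move=> Ex; have [c0|c0] := eqVneq (cheb4 (1 - x)) 0.
  by apply: Or44; apply: exceptional_list.
have cK := cheb4D_neq0 (1 - x) k_ge2.
pose s := 1 -
  ((K + 1) * (1 - x) * cheb4 (1 - x) - K * cheb3 (1 - x)) / (cheb4 (1 - x) + K).
have rt : root (khex_quintic k s) x.
  by rewrite root_khex_quintic /s subKr [_ * (_ / _)]mulrC divfK.
have Es : eigenvalue L s.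
  by rewrite eigenvalue_mult // -(mult_khex_root c0 rt) -eigenvalue_mult.
have [s0|s0] := eqVneq s 0.
  apply: Or42; move: rt c0; rewrite s0 rootE khex_quintic0 cheb4_factor.
  rewrite [_ * _ * sigma0_quadratic _ == 0]mulf_eq0 sigma0_quadratic_pos_roots.
  rewrite orbC => /orP[xl _|]; first by rewrite in_cons xl orbT.
  rewrite mulf_eq0 => /orP[/eqP h _|/eqP->]; last by rewrite mul0r eqxx.
  by rewrite in_cons; apply/orP; left; apply/eqP; lra.
have [s2|s2] := eqVneq s 2; last by apply: Or41; exists s.
apply: Or43; split.
  move: Es; rewrite s2 eigenvalue_walk //.
  have -> : 1 - 2 = -1 :> R by ring.
  exact: bipartite_of_walk.
move: rt c0; rewrite s2 rootE khex_quintic2 cheb4_factor.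
rewrite [_ * _ * sigma0_quadratic _ == 0]mulf_eq0 sigma0_quadratic_neg_roots.
rewrite orbC => /orP[xl _|]; first by rewrite in_cons xl orbT.
rewrite mulf_eq0 => /orP[/eqP h _|/eqP->]; last by rewrite mulr0 eqxx.
by rewrite in_cons; apply/orP; left; apply/eqP; lra.
Qed.

End OneStep.
Theorem theorem2p3 (R : rcfType) (G : sgraph) (k n : nat)
    (hconn : connected G) (hedge : exists x y : G, adj x y)
    (hk : (2 <= k)%N) (hn : (1 <= n)%N) :
  let L := normalized_laplacian R (khex_iter k n G) in
  let L' := normalized_laplacian R (khex_iter k n.-1 G) in
  let N' : int := Posz (graph_order (khex_iter k n.-1 G)) in
  let E' : int := Posz (graph_size (khex_iter k n.-1 G)) in
  let K : R := k%:R in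
  let r : R := Num.sqrt (5 * K ^+ 2 + 6 * K + 5) in
  let r5 : R := Num.sqrt 5 in
  (* (i) *)
  (forall s : R, eigenvalue L' s -> s != 0 -> s != 2 ->
     exists lam : 5.-tuple R,
       khex_quintic k s = (16 * K + 16) *: \prod_(x <- lam) ('X - x%:P) /\
       (forall i : 'I_5, eigenvalue L (tnth lam i) /\
                         mult L (tnth lam i) = mult L' s)) /\
  (* (ii) *)
  [/\ mult L 0 = 1%N,
      mult L ((5 * K + 3 - r) / (4 * (K + 1))) = 1%N
    & mult L ((5 * K + 3 + r) / (4 * (K + 1))) = 1%N] /\
  (* (iii) *)
  (bipartite G ->
     [/\ mult L 2 = 1%N,
         mult L ((3 * K + 5 - r) / (4 * (K + 1))) = 1%N
       & mult L ((3 * K + 5 + r) / (4 * (K + 1))) = 1%N]) /\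
  (* (iv) *)
  (Posz (mult L ((5 - r5) / 4)) = Posz k * E' - N' + 1 /\
   Posz (mult L ((5 + r5) / 4)) = Posz k * E' - N' + 1) /\
  (* (v) *)
  (bipartite G ->
     Posz (mult L ((3 - r5) / 4)) = Posz k * E' - N' + 1 /\
     Posz (mult L ((3 + r5) / 4)) = Posz k * E' - N' + 1) /\
  (* (vi) *)
  (~ bipartite G ->
     Posz (mult L ((3 - r5) / 4)) = Posz k * E' - N' /\
     Posz (mult L ((3 + r5) / 4)) = Posz k * E' - N') /\
  (* every eigenvalue is one of those listed above *)
  (forall x : R, eigenvalue L x ->
     [\/ exists s : R, [/\ eigenvalue L' s, s != 0, s != 2
                         & root (khex_quintic k s) x],
         x \in [:: 0; (5 * K + 3 - r) / (4 * (K + 1));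
                      (5 * K + 3 + r) / (4 * (K + 1))],
         bipartite G /\
         x \in [:: 2; (3 * K + 5 - r) / (4 * (K + 1));
                      (3 * K + 5 + r) / (4 * (K + 1))]
       | x \in [:: (5 - r5) / 4; (5 + r5) / 4;
                   (3 - r5) / 4; (3 + r5) / 4]]).
Proof.
case: n hn => // m _.
rewrite -[m.+1.-1]/m -[khex_iter k m.+1 G]/(khex k (khex_iter k m G)).
have conn := khex_iter_connected (k := k) (n := m) hconn.
have edge := khex_iter_has_edge k m hedge.
have bipE := khex_iter_bipartite k G m.
set G' := khex_iter k m G in conn edge bipE *.
move=> L L' N' E' K r r5.
split; first by move=> s; apply: khex_eigenvalues_lift.
split.
  by split; apply: mult_khex_sigma0 => //; rewrite !inE eqxx ?orbT.
split.
  by move=> /bipE bip; split; apply: mult_khex_sigma2 => //; rewrite !inE eqxx ?orbT.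
have minus x : x \in [:: (5 - r5) / 4; (5 + r5) / 4] ->
    Posz (mult L x) = Posz k * E' - N' + 1.
  by move/(mult_khex_five conn edge hk); rewrite -/L /E' /N'; lia.
have plus x : x \in [:: (3 - r5) / 4; (3 + r5) / 4] ->
    Posz (mult L x) = Posz k * E' - N' + Posz (mult L' 2).
  by move/(mult_khex_three conn edge hk); rewrite -/L -/L' /E' /N'; lia.
split; first by split; apply: minus; rewrite !inE eqxx ?orbT.
split.
  move=> /bipE bip; have m2 := mult2 R conn edge bip.
  by split; rewrite plus ?inE ?eqxx ?orbT // m2.
split.
  move=> nb; have {}nb : ~ bipartite G' by move/bipE.
  have m2 := mult2_nonbipartite R conn edge nb.
  by split; rewrite plus ?inE ?eqxx ?orbT // m2 addr0.
move=> x /(khex_eigenvalue_cases conn edge hk)[s|xl|[bip xl]|xl].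
- by apply: Or41.
- by apply: Or42.
- by apply: Or43; split=> //; apply/bipE.
- by apply: Or44.
Qed.
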